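(* The group $V_\beta$ has a normal subgroup of index $4$.
   Context: Let $\beta=\sqrt2-1$, the positive root of $X^2+2X-1$, so $1=2\beta+\beta^2$. There are three types of carets, each subdividing an interval $(a,a+L]$ into three consecutive intervals, with lengths, from left to right: $x$-caret: $\beta^2L,\beta L,\beta L$; $y$-caret: $\beta L,\beta^2L,\beta L$; $z$-caret: $\beta L,\beta L,\beta^2L$. A tree is a finite rooted ternary tree whose interior nodes (carets) are each of one of these three types; with root $(0,1]$, its leaves, ordered from left to right, give a subdivision of $(0,1]$. A triple $(T,\pi,S)$, with $T,S$ trees with the same number $k$ of leaves and $\pi$ a permutation of the $k$ leaf positions, represents the bijection of $(0,1]$ mapping the interval of leaf $i$ of $S$ affinely and increasingly onto the interval of leaf $\pi(i)$ of $T$. $V_\beta$ is the group, under composition, of all bijections of $(0,1]$ represented by such triples. *)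

(* Defs.v *)
From HB Require Import structures.
From mathcomp Require Import all_boot all_order all_algebra all_fingroup.
From mathcomp Require Import boolp classical_sets functions cardinality reals.

Set Implicit Arguments.
Unset Strict Implicit.
Unset Printing Implicit Defensive.

Import Order.TTheory GRing.Theory Num.Theory.

(* The group of all bijections of an arbitrary type, under composition.  By
   functional extensionality and proof irrelevance, an element is determined by
   its underlying function (lemma [bijection_eq]). *)
Record bijection (T : Type) := Bijection {
  bij_fun :> T -> T;
  bij_inv : T -> T;
  bij_funK : cancel bij_fun bij_inv;
  bij_invK : cancel bij_inv bij_fun
}.

Lemma bijection_eq (T : Type) (f g : bijection T) : f =1 g -> f = g.
Proof.
case: f g => [f f' fK f'K] [g g' gK g'K] /= /funext efg; subst g.
have eg : f' = g' by apply/funext => x; rewrite -{1}(g'K x) fK.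
by subst g'; congr Bijection; apply: Prop_irrelevance.
Qed.

HB.instance Definition _ (T : Type) := gen_eqMixin (bijection T).
HB.instance Definition _ (T : Type) := gen_choiceMixin (bijection T).

Section BijectionGroup.
Context {T : Type}.
Implicit Types f g h : bijection T.

Definition bij_one : bijection T :=
  @Bijection T id id (fun=> erefl) (fun=> erefl).

Definition bij_mul f g : bijection T :=
  Bijection (can_comp (bij_funK f) (bij_funK g))
            (can_comp (bij_invK g) (bij_invK f)).

Definition bij_V f : bijection T := Bijection (bij_invK f) (bij_funK f).

Lemma bij_mulA : associative bij_mul.
Proof. by move=> f g h; apply: bijection_eq. Qed.

Lemma bij_mul1 : left_id bij_one bij_mul.
Proof. by move=> f; apply: bijection_eq. Qed.

Lemma bij_mulr1 : right_id bij_one bij_mul.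
Proof. by move=> f; apply: bijection_eq. Qed.

Lemma bij_mulV : left_inverse bij_one bij_V bij_mul.
Proof. by move=> f; apply: bijection_eq => x /=; rewrite bij_funK. Qed.

Lemma bij_mulrV : right_inverse bij_one bij_V bij_mul.
Proof. by move=> f; apply: bijection_eq => x /=; rewrite bij_invK. Qed.

End BijectionGroup.

HB.instance Definition _ (T : Type) := isGroup.Build (bijection T)
  bij_mulA bij_mul1 bij_mulr1 bij_mulV bij_mulrV.

Section Subgroups.
Local Open Scope classical_set_scope.
Local Open Scope group_scope.
Context {G : groupType}.
Implicit Types H N : set G.

Definition subgroup H : Prop := group_closed (mem H).

(* N is a normal subgroup of H, where H is itself a subgroup of G. *)
Definition normal_subgroup N H : Prop :=
  [/\ subgroup H, subgroup N, N `<=` H &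
      forall h n, H h -> N n -> N (n ^ h)].

Definition left_coset (h : G) N : set G := [set h * n | n in N].

Definition left_cosets N H : set (set G) := [set left_coset h N | h in H].

Definition has_index N H (k : nat) : Prop := (left_cosets N H #= `I_k)%card.

End Subgroups.

Local Open Scope ring_scope.

Inductive caret := XCaret | YCaret | ZCaret.

Inductive tree := Leaf | Node of caret & tree & tree & tree.

Section Vbeta.
Context (R : realType).

Definition beta : R := Num.sqrt 2 - 1.

Definition caret_lengths (c : caret) (L : R) : R * R * R :=
  match c with
  | XCaret => (beta ^+ 2 * L, beta * L, beta * L)
  | YCaret => (beta * L, beta ^+ 2 * L, beta * L)
  | ZCaret => (beta * L, beta * L, beta ^+ 2 * L)
  end.

(* The leaves of t, from left to right, when the root of t is the interval
   (a, a + L]; the pair (b, M) stands for the interval (b, b + M]. *)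
Fixpoint leaf_intervals (t : tree) (a L : R) : seq (R * R) :=
  match t with
  | Leaf => [:: (a, L)]
  | Node c t1 t2 t3 =>
      let: (L1, L2, L3) := caret_lengths c L in
      leaf_intervals t1 a L1 ++ leaf_intervals t2 (a + L1) L2
        ++ leaf_intervals t3 (a + L1 + L2) L3
  end.

Definition leaves (t : tree) : seq (R * R) := leaf_intervals t 0 1.

Definition unit_ioc : Type := {x : R | x \in `]0, 1]}.

(* f is the bijection represented by (T, p, S): on the interval (a, a + L] of
   the i-th leaf of S, it is the increasing affine map onto the interval
   (b, b + M] of the p(i)-th leaf of T. *)
Definition represents (k : nat) (T : tree) (p : 'S_k) (S : tree)
    (f : bijection unit_ioc) : Prop :=
  [/\ size (leaves T) = k, size (leaves S) = k &
      forall (i : 'I_k) (x : unit_ioc),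
        let: (a, L) := nth (0, 0) (leaves S) i in
        let: (b, M) := nth (0, 0) (leaves T) (p i) in
        val x \in `]a, a + L] -> val (f x) = b + M / L * (val x - a)].

Definition Vbeta : set (bijection unit_ioc) :=
  [set f | exists (k : nat) (T S : tree) (p : 'S_k), represents T p S f]%classic.

End Vbeta.

Arguments Vbeta R : clear implicits.

(* Main.v *)
Require Import Defs.
From mathcomp Require Import all_boot all_order all_algebra all_fingroup.
From mathcomp Require Import boolp classical_sets functions cardinality reals.
From mathcomp Require Import ring lra zify.

Set Implicit Arguments.
Unset Strict Implicit.
Unset Printing Implicit Defensive.

Import Order.TTheory GRing.Theory Num.Theory.
Local Open Scope ring_scope.

(** Two homomorphisms from V_beta to Z/2 give a surjection onto (Z/2)^2, and its
    kernel is the required subgroup.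

    An element f of V_beta is described by a chart: a finite list of pairs
    (source interval, target interval), where the sources are the leaves of one
    tree, the targets are the leaves of another, and f is affine from each
    source onto its target.  Keeping the pairs in an arbitrary order replaces
    the permutation of a tree pair diagram by the list itself, so that inverting
    f swaps the two components and composing two charts that share their middle
    intervals is a matter of reordering one of them.

    A weight k assigns a bit to an ordered pair of disjoint intervals.  The
    defect of a chart is the sum mod 2, over all unordered pairs of its entries,
    of the weight of the sources plus the weight of the targets.  By
    construction it is additive under composition and vanishes on the identity.
    It does not change when an entry is split by a caret as soon as the weight
    is additive: the three children together weigh against any other interval
    as much as their parent does, and their weights against each other depend
    on the caret only, hence cancel between source and target.  Two weights have
    this property.
    - The order weight, telling which interval comes first.  Its defect is the
      sign of the permutation of the diagram; a caret has an odd number of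
      children, which is why the sign survives splitting.
    - The level weight.  An interval of length beta^n has level n; the weight of
      a pair is 1 when the leftmost interval has odd level and the other one has
      even level.  The children of an interval of level n have levels n+1, n+1,
      n+2, with the last one placed according to the caret, and the sum of the
      weights of the three pairs is 1 exactly for a y-caret.  Its defect is thus
      the parity of the number of y-carets in the two trees.

    Exchanging the first two leaves of a z-caret has values (1, 0); mapping an
    x-caret to a y-caret by an exchange of the first two leaves has values
    (1, 1); so the map to (Z/2)^2 is onto.

    That V_beta is a group, and that the defects are homomorphisms, rests on
    lemma common_refinement: any two trees can be expanded to trees with the
    same leaves.  It follows from lemma reroot: every tree can be expanded so
    that its leaves become those of a tree with a prescribed root caret.  This
    goes by induction on the tree, because of two coincidences between
    two-caret subdivisions (relation_xy and relation_yz), both of which express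
    1 = 2 beta + beta^2. *)

(** * Parity sums over pairs of list entries *)

Section PairParity.
Variable A : Type.
Implicit Types (k : A -> A -> bool) (s t : seq A).

Fixpoint pair_parity k s : bool :=
  if s is x :: s' then \big[addb/false]_(y <- s') k x y (+) pair_parity k s'
  else false.

Lemma pair_parity_cat k s t :
  pair_parity k (s ++ t) = pair_parity k s (+) pair_parity k t
    (+) \big[addb/false]_(x <- s) \big[addb/false]_(y <- t) k x y.
Proof.
elim: s => [|x s IHs] /=; first by rewrite big_nil addbF.
rewrite big_cat big_cons IHs.
set a := (X in _ = X (+) _ (+) _ (+) _); set b := bigop _ t _.
set c := bigop _ s _; move: (pair_parity k s) (pair_parity k t) => d e.
by rewrite -!addbA; congr addb; case: b; case: c; case: d; case: e.
Qed.

Lemma pair_parity_addb k l s :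
  pair_parity (fun x y => k x y (+) l x y) s
    = pair_parity k s (+) pair_parity l s.
Proof.
elim: s => //= x s ->; rewrite big_split /=.
by rewrite !addbA; congr addb; rewrite -!addbA; congr addb; apply: addbC.
Qed.

End PairParity.

Lemma pair_parity_map (A B : Type) (h : B -> A) (k : A -> A -> bool)
    (s : seq B) :
  pair_parity k (map h s) = pair_parity (fun x y => k (h x) (h y)) s.
Proof. by elim: s => //= x s ->; rewrite big_map. Qed.


Lemma pairwise_perm (A : eqType) (r : rel A) (s t : seq A) :
  symmetric r -> perm_eq s t -> pairwise r s -> pairwise r t.
Proof.
move=> r_sym; apply: (catCA_perm_ind (P := pairwise r)) => {s t} s1 s2 s3.
rewrite !pairwise_cat !allrel_catr.
have -> : allrel r s2 s1 = allrel r s1 s2.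
  by rewrite allrelC; apply: eq_allrel => x y; apply: r_sym.
by move=> /and3P[/andP[-> ->] -> /and3P[-> -> ->]].
Qed.

(** Over unordered pairs the sum makes sense as soon as the two orders of each
    pair give the same value. *)
Lemma pair_parity_perm (A : eqType) (k : A -> A -> bool) (s t : seq A) :
  pairwise (fun x y => k x y == k y x) s -> perm_eq s t ->
  pair_parity k s = pair_parity k t.
Proof.
pose r x y := k x y == k y x; have r_sym : symmetric r by move=> x y; apply: eq_sym.
move=> s_sym eq_st; suff [] : pairwise r t /\ pair_parity k s = pair_parity k t by [].
pose P u := pairwise r u /\ pair_parity k s = pair_parity k u.
apply: (catCA_perm_ind (P := P) _ eq_st) => // s1 s2 s3 [sym eq_s]; split.
  by apply: pairwise_perm sym; rewrite // perm_catCA.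
rewrite eq_s !pair_parity_cat.
move: sym; rewrite pairwise_cat allrel_catr => /andP[/andP[/allrelP sym12 _] _].
have cross : \big[addb/false]_(x <- s1) \big[addb/false]_(y <- s2) k x y
           = \big[addb/false]_(x <- s2) \big[addb/false]_(y <- s1) k x y.
  rewrite exchange_big /= big_seq [RHS]big_seq; apply: eq_bigr => y ys2.
  by rewrite big_seq [RHS]big_seq; apply: eq_bigr => x xs1; apply/eqP/sym12.
have split (u v w : seq A) : \big[addb/false]_(x <- u)
    \big[addb/false]_(y <- v ++ w) k x y
  = \big[addb/false]_(x <- u) \big[addb/false]_(y <- v) k x y (+)
    \big[addb/false]_(x <- u) \big[addb/false]_(y <- w) k x y.
  by rewrite -big_split; apply: eq_bigr => x _; rewrite big_cat.
rewrite !split cross.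
set a := bigop _ _ _; set b := bigop _ _ _; set c := bigop _ _ _.
move: (pair_parity k s1) (pair_parity k s2) (pair_parity k s3) => d e f.
by case: a; case: b; case: c; case: d; case: e; case: f.
Qed.

Lemma perm_map_lift (A B : eqType) (h : A -> B) (s : seq A) (t : seq B) :
  perm_eq (map h s) t -> exists2 s', perm_eq s' s & map h s' = t.
Proof.
case: s => [|x0 s0]; first by rewrite perm_sym => /perm_nilP->; exists [::].
set s := x0 :: s0; rewrite perm_sym => /(perm_iotaP (h x0)) [I].
rewrite size_map => permI ->; exists (map (nth x0 s) I).
  by apply/(perm_iotaP x0); exists I.
rewrite -map_comp; apply/eq_in_map => i; rewrite (perm_mem permI) mem_iota.
by move=> /andP[_ lt_i]; rewrite (nth_map x0).
Qed.

(** * Kernels of homomorphisms onto finite groups *)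

Section Kernel.
Local Open Scope classical_set_scope.
Variables (G : groupType) (A : zmodType) (H : set G) (phi : G -> A).
Hypothesis subH : subgroup H.
Hypothesis phiM : forall g h, H g -> H h -> phi (g * h)%g = phi g + phi h.

Let N : set G := [set g | H g /\ phi g = 0].

Lemma kernel_normal : normal_subgroup N H.
Proof.
have H1 : H 1%g by case: subH => /set_mem.
have HM g h : H g -> H h -> H (g * h)%g.
  by move=> /mem_set Hg /mem_set Hh; apply/set_mem/(group_closedM subH).
have HV g : H g -> H g^-1%g.
  by move=> /mem_set Hg; apply/set_mem/(group_closedV subH).
have phi1 : phi 1%g = 0.
  by apply: (addrI (phi 1%g)); rewrite -phiM // mulg1 addr0.
have phiV g : H g -> phi g^-1%g = - phi g.
  move=> Hg; apply: (addrI (phi g)); rewrite -phiM ?subrr ?mulgV //.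
  exact: HV.
split=> //.
- split; first exact/mem_set.
  move=> g h /set_mem[Hg g0] /set_mem[Hh h0]; apply/mem_set.
  split; first exact/HM/HV.
  by rewrite phiM ?phiV // ?g0 ?h0 ?subr0 //; apply: HV.
- by move=> g [].
- move=> h n Hh [Hn n0]; have HVh := HV h Hh; have Hnh := HM _ _ Hn Hh.
  by split; [apply: HM | rewrite !phiM ?phiV ?n0 ?add0r ?addNr].
Qed.

Lemma kernel_index (n : nat) :
  (forall a, exists2 g, H g & phi g = a) -> ([set: A] #= `I_n)%card ->
  has_index N H n.
Proof.
move=> phi_surj cardA.
have HM g h : H g -> H h -> H (g * h)%g.
  by move=> /mem_set Hg /mem_set Hh; apply/set_mem/(group_closedM subH).
have HV g : H g -> H g^-1%g.
  by move=> /mem_set Hg; apply/set_mem/(group_closedV subH).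
pose F a : set G := [set g | H g /\ phi g = a].
have cosetE h : H h -> left_coset h N = F (phi h).
  move=> Hh; apply/seteqP; split=> [_ [n0 [Hn n00] <-]|g [Hg gh]].
    by split; [apply: HM | rewrite phiM ?n00 ?addr0].
  have HVg : H (h^-1 * g)%g by apply: HM => //; apply: HV.
  exists (h^-1 * g)%g; last by rewrite mulKVg.
  split=> //; apply: (addrI (phi h)).
  by rewrite -phiM // mulKVg gh addr0.
rewrite /has_index (_ : left_cosets N H = [set F a | a in [set: A]]).
  apply: card_eq_trans cardA; apply: inj_card_eq => a b _ _ Fab.
  have [g Hg ga] := phi_surj a.
  by have [_ <-] : F b g by rewrite -Fab.
apply/seteqP; split=> [_ [h Hh <-]|_ [a _ <-]].
  by exists (phi h); rewrite ?cosetE.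
by have [g Hg <-] := phi_surj a; exists g; rewrite ?cosetE.
Qed.

End Kernel.


(** * Carets and the intervals they produce *)

Section Intervals.
Variable R : realType.
Local Notation beta := (beta R).
Local Notation interval := (R * R)%type.
Implicit Types (c : caret) (t : tree) (u v w o : interval) (s : seq interval).

Lemma beta_sqr : beta ^+ 2 = 1 - 2 * beta.
Proof.
rewrite /Defs.beta sqrrB sqr_sqrtr ?ler0n // expr1n; ring.
Qed.

Lemma beta_gt0 : 0 < beta.
Proof. by rewrite subr_gt0 -{1}(@sqrtr1 R) ltr_sqrt ?ltr1n ?ltr0n. Qed.

Lemma beta_sqr_gt0 : 0 < beta ^+ 2.
Proof. by rewrite exprn_gt0 ?beta_gt0. Qed.

Lemma beta_lt1 : beta < 1.
Proof. by have := beta_sqr; have := beta_gt0; nra. Qed.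

Lemma beta_expn_inj : injective (fun n => beta ^+ n).
Proof.
move=> m n; wlog le_mn : m n / (m <= n)%N => [wl eq_mn|eq_mn].
  by case: (leqP m n) => [/wl->|/ltnW/wl->].
apply/eqP; rewrite eqn_leq le_mn /= leqNgt; apply/negP => lt_mn.
move/eqP: eq_mn; rewrite gt_eqF // ltr_iXn2l //.
- exact: beta_gt0.
- exact: beta_lt1.
Qed.

(** The image of the interval o of (0, 1] under the affine map of (0, 1] onto
    the interval u. *)
Definition cell u o : interval := (u.1 + o.1 * u.2, o.2 * u.2).

Definition cells c : seq interval :=
  match c with
  | XCaret => [:: (0, beta ^+ 2); (beta ^+ 2, beta); (beta ^+ 2 + beta, beta)]
  | YCaret => [:: (0, beta); (beta, beta ^+ 2); (beta + beta ^+ 2, beta)]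
  | ZCaret => [:: (0, beta); (beta, beta); (beta + beta, beta ^+ 2)]
  end.

Definition children c u := map (cell u) (cells c).

(** Taking the root as a single argument lets children be passed around as
    intervals. *)
Definition intervals_in t u := leaf_intervals t u.1 u.2.

Lemma intervals_in_Node c t1 t2 t3 u :
  intervals_in (Node c t1 t2 t3) u =
    intervals_in t1 (cell u (cells c)`_0) ++
    intervals_in t2 (cell u (cells c)`_1) ++
    intervals_in t3 (cell u (cells c)`_2).
Proof.
case: c; rewrite /intervals_in /=; congr (_ ++ (_ ++ _)); congr leaf_intervals; ring.
Qed.

Lemma intervals_in_Leaf u : intervals_in Leaf u = [:: u].
Proof. by case: u. Qed.

Lemma leavesE t : leaves R t = intervals_in t (0, 1).
Proof. by []. Qed.

(** * Disjointness of the leaves *)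

(** The properties of a single leaf that later arguments use: its length has a
    level, and it lies in (0, 1]. *)
Definition standard u := [/\ exists n, u.2 = beta ^+ n, 0 <= u.1 & u.1 + u.2 <= 1].

Definition apart u v := (u.1 + u.2 <= v.1) || (v.1 + v.2 <= u.1).

Definition inside u v := (u.1 <= v.1) && (v.1 + v.2 <= u.1 + u.2).

Lemma standard_gt0 u : standard u -> 0 < u.2.
Proof. by case=> [[n ->] _ _]; rewrite exprn_gt0 ?beta_gt0. Qed.

Lemma apart_sym : symmetric apart.
Proof. by move=> u v; rewrite /apart orbC. Qed.

Lemma inside_trans : transitive inside.
Proof.
by move=> v u w /andP[uv1 uv2] /andP[vw1 vw2]; rewrite /inside; lra.
Qed.

Lemma cells_cases c o : o \in cells c ->
  [/\ 0 <= o.1, o.1 + o.2 <= 1 & o.2 = beta \/ o.2 = beta ^+ 2].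
Proof.
have := beta_sqr_gt0; have := beta_gt0; have := beta_sqr => b2 b0 b20.
by case: c; rewrite /cells !inE => /or3P[] /eqP-> /=; split; try lra; auto.
Qed.

Lemma child_standard c u v : standard u -> v \in children c u ->
  standard v /\ inside u v.
Proof.
move=> u_std; have u0 := standard_gt0 u_std; case: u_std => [[n un] ge0 le1].
case/mapP=> o /cells_cases[o1 o12 oE] ->; rewrite /standard /inside /cell /=.
have in1 : u.1 <= u.1 + o.1 * u.2 by nra.
have in2 : u.1 + o.1 * u.2 + o.2 * u.2 <= u.1 + u.2 by nra.
split; last by rewrite in1.
split; [|lra|lra].
case: oE => ->; rewrite un; first by exists n.+1; rewrite exprS.
by exists (2 + n)%N; rewrite exprD.
Qed.

Lemma children_apart c u : standard u -> pairwise apart (children c u).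
Proof.
move=> /standard_gt0; case: u => a L /= L0.
have bL := mulr_gt0 beta_gt0 L0; have b2L := mulr_gt0 beta_sqr_gt0 L0.
case: c; rewrite /= /apart /= !andbT -andbA;
  by apply/and3P; split; apply/orP; left; lra.
Qed.

Lemma intervals_in_standard t u : standard u ->
  pairwise apart (intervals_in t u) /\
  (forall v, v \in intervals_in t u -> standard v /\ inside u v).
Proof.
elim: t u => [|c t1 IH1 t2 IH2 t3 IH3] u u_std.
  rewrite intervals_in_Leaf; split=> // v; rewrite inE => /eqP->.
  by split; rewrite // /inside !lexx.
pose C i := cell u (cells c)`_i.
have inC i : (i < 3)%N -> C i \in children c u.
  by move=> lt_i3; apply/map_f/mem_nth; case: (c).
have stdC i lt_i := child_standard u_std (inC i lt_i).
have apartC : [&& apart (C 0) (C 1), apart (C 0) (C 2) & apart (C 1) (C 2)].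
  move: (children_apart c u_std).
  by rewrite /children /C; case: (c); rewrite /= !andbT -andbA.
have [] := (stdC 0 isT, stdC 1 isT); have [] := stdC 2 isT.
move=> std2 in2 [std0 in0] [std1 in1].
have [ap1 all1] := IH1 _ std0; have [ap2 all2] := IH2 _ std1.
have [ap3 all3] := IH3 _ std2.
have apart_inside v v' w w' : apart v v' -> inside v w -> inside v' w' ->
    0 < w.2 -> 0 < w'.2 -> apart w w'.
  rewrite /apart /inside => ap /andP[? ?] /andP[? ?] ? ?.
  by case/orP: ap => ?; apply/orP; [left|right]; lra.
have cross i j s s' : apart (C i) (C j) ->
    (forall v, v \in s -> standard v /\ inside (C i) v) ->
    (forall v, v \in s' -> standard v /\ inside (C j) v) -> allrel apart s s'.
  move=> ap alls alls'; apply/allrelP => v w /alls[/standard_gt0 v0 inv].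
  by move=> /alls'[/standard_gt0 w0 inw]; apply: apart_inside ap inv inw v0 w0.
case/and3P: apartC => ap01 ap02 ap12.
rewrite intervals_in_Node; split.
  rewrite !pairwise_cat allrel_catr ap1 ap2 ap3.
  rewrite (cross _ _ _ _ ap01 all1 all2) (cross _ _ _ _ ap02 all1 all3).
  by rewrite (cross _ _ _ _ ap12 all2 all3).
move=> v; rewrite !mem_cat => /or3P[/all1|/all2|/all3] [std_v in_v]; split=> //.
- exact: inside_trans in0 in_v.
- exact: inside_trans in1 in_v.
- exact: inside_trans in2 in_v.
Qed.

(** * Subdivisions *)

(** Up to reordering, since sources and targets of a chart cannot be listed from
    left to right at the same time. *)
Definition subdivision s := exists t, perm_eq s (leaves R t).

Lemma unit_standard : standard (0, 1).
Proof. by split=> //=; [exists 0%N | rewrite add0r]. Qed.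

Lemma subdivision_apart s : subdivision s -> pairwise apart s.
Proof.
case=> t; rewrite perm_sym => /pairwise_perm; apply; first exact: apart_sym.
by have [] := intervals_in_standard t unit_standard.
Qed.

Lemma subdivision_standard s u : subdivision s -> u \in s -> standard u.
Proof.
case=> t /perm_mem-> u_t.
by have [_ /(_ _ u_t)[]] := intervals_in_standard t unit_standard.
Qed.

(** Growing a caret c on the leaf v turns t into t'; the multiset of leaves
    loses v and gains its children, which is written without subtraction. *)
Lemma intervals_in_subdivide c t u v : v \in intervals_in t u ->
  exists t', perm_eq (v :: intervals_in t' u) (children c v ++ intervals_in t u).
Proof.
elim: t u => [|d t1 IH1 t2 IH2 t3 IH3] u.
  rewrite intervals_in_Leaf inE => /eqP->; exists (Node c Leaf Leaf Leaf).
  rewrite intervals_in_Node !intervals_in_Leaf perm_sym perm_catC.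
  by rewrite /children; case: (c).
rewrite intervals_in_Node !mem_cat => /or3P[].
- case/IH1 => t' /seq.permP eq_t'; exists (Node d t' t2 t3).
  rewrite intervals_in_Node; apply/seq.permP => p; move: (eq_t' p).
  by rewrite /= !count_cat; lia.
- case/IH2 => t' /seq.permP eq_t'; exists (Node d t1 t' t3).
  rewrite intervals_in_Node; apply/seq.permP => p; move: (eq_t' p).
  by rewrite /= !count_cat; lia.
- case/IH3 => t' /seq.permP eq_t'; exists (Node d t1 t2 t').
  rewrite intervals_in_Node; apply/seq.permP => p; move: (eq_t' p).
  by rewrite /= !count_cat; lia.
Qed.

Lemma subdivision_step c u s :
  subdivision (u :: s) -> subdivision (children c u ++ s).
Proof.
case=> t eq_t; have u_t : u \in intervals_in t (0, 1).
  by rewrite -[intervals_in _ _]leavesE -(perm_mem eq_t) mem_head.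
have [t' eq_t'] := intervals_in_subdivide c u_t; exists t'.
apply/seq.permP => p; move/seq.permP/(_ p): eq_t; move/seq.permP/(_ p): eq_t'.
by rewrite !leavesE /= !count_cat; lia.
Qed.

(** * Common refinements *)

Inductive refines : seq interval -> seq interval -> Prop :=
| RefinesRefl s : refines s s
| RefinesStep s1 c u s2 s' :
    refines (s1 ++ children c u ++ s2) s' -> refines (s1 ++ u :: s2) s'.

Lemma refines_trans s2 s1 s3 : refines s1 s2 -> refines s2 s3 -> refines s1 s3.
Proof.
elim=> // {s1 s2} s1 c u s2 s' _ IH ref_s'; exact: (RefinesStep (IH ref_s')).
Qed.

Lemma refines_catl r s s' : refines s s' -> refines (r ++ s) (r ++ s').
Proof.
elim=> [{}s|{s s'} s1 c u s2 s' _ IH]; first exact: RefinesRefl.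
rewrite catA; apply: (@RefinesStep _ c); by rewrite -catA.
Qed.

Lemma refines_catr r s s' : refines s s' -> refines (s ++ r) (s' ++ r).
Proof.
elim=> [{}s|{s s'} s1 c u s2 s' _ IH]; first exact: RefinesRefl.
rewrite -catA /=; apply: (@RefinesStep _ c); by move: IH; rewrite -!catA.
Qed.

Lemma refines_cat s1 s2 s1' s2' :
  refines s1 s1' -> refines s2 s2' -> refines (s1 ++ s2) (s1' ++ s2').
Proof.
move=> ref1 ref2; apply: (@refines_trans (s1' ++ s2)).
  exact: refines_catr.
exact: refines_catl.
Qed.

Definition tree_refines t t' :=
  forall u, refines (intervals_in t u) (intervals_in t' u).

Lemma tree_refines_trans t2 t1 t3 :
  tree_refines t1 t2 -> tree_refines t2 t3 -> tree_refines t1 t3.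
Proof. by move=> r12 r23 u; apply: refines_trans (r12 u) (r23 u). Qed.

Lemma tree_refines_refl t : tree_refines t t.
Proof. by move=> u; apply: RefinesRefl. Qed.

Lemma tree_refines_Node c t1 t2 t3 t1' t2' t3' :
  tree_refines t1 t1' -> tree_refines t2 t2' -> tree_refines t3 t3' ->
  tree_refines (Node c t1 t2 t3) (Node c t1' t2' t3').
Proof.
by move=> r1 r2 r3 u; rewrite !intervals_in_Node; do !apply: refines_cat.
Qed.

Lemma tree_refines_Leaf t : tree_refines Leaf t.
Proof.
elim: t => [|c t1 IH1 t2 IH2 t3 IH3]; first exact: tree_refines_refl.
apply: (@tree_refines_trans (Node c Leaf Leaf Leaf)) => [u|]; last first.
  exact: tree_refines_Node.
rewrite intervals_in_Leaf -[[:: u]]cat0s; apply: (@RefinesStep _ c).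
rewrite intervals_in_Node !intervals_in_Leaf /children.
by case: (c); apply: RefinesRefl.
Qed.

(** Both sides cut the root at the same four points: the middle child of the
    x-caret starts at beta^2 and its last third, of length beta^2, starts at
    beta = 2 beta^2 + beta^3. *)
Lemma relation_xy t1 t2 t3 t4 t5 u :
  intervals_in (Node XCaret t1 (Node YCaret t2 t3 t4) t5) u =
  intervals_in (Node YCaret (Node ZCaret t1 t2 t3) t4 t5) u.
Proof.
rewrite !intervals_in_Node /= -!catA; have b2 := beta_sqr.
by congr (_ ++ (_ ++ (_ ++ (_ ++ _)))); congr intervals_in;
  rewrite /cell /=; congr pair; ring: b2.
Qed.

(** The same coincidence as relation_xy, between the last two children. *)
Lemma relation_yz t1 t2 t3 t4 t5 u :
  intervals_in (Node YCaret t1 t2 (Node YCaret t3 t4 t5)) u =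
  intervals_in (Node ZCaret t1 (Node ZCaret t2 t3 t4) t5) u.
Proof.
rewrite !intervals_in_Node /= -!catA; have b2 := beta_sqr.
by congr (_ ++ (_ ++ (_ ++ (_ ++ _)))); congr intervals_in;
  rewrite /cell /=; congr pair; ring: b2.
Qed.

(** A y-root on the middle child of an x-caret, or a z-root on the first child
    of a y-caret, converts the x-caret and the y-caret into each other by
    relation_xy; relation_yz does the same for y and z.  The induction
    hypothesis supplies these roots in the original subtrees, and passing
    between x and z through y needs them in two different subtrees only. *)
Lemma reroot t c : exists t1 t2 t3, tree_refines t (Node c t1 t2 t3).
Proof.
elim: t c => [|d A IHA B IHB C IHC] c.
  by exists Leaf, Leaf, Leaf; apply: tree_refines_Leaf.
have [A1 [A2 [A3 refAz]]] := IHA ZCaret.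
have [B1 [B2 [B3 refBy]]] := IHB YCaret.
have [B4 [B5 [B6 refBz]]] := IHB ZCaret.
have [C1 [C2 [C3 refCy]]] := IHC YCaret.
have refl_t := tree_refines_refl.
case: d; case: c.
- by exists A, B, C.
- exists (Node ZCaret A B1 B2), B3, C => u.
  by rewrite -relation_xy; apply: tree_refines_Node.
- exists (Node ZCaret A B1 B2), (Node ZCaret B3 C1 C2), C3 => u.
  by rewrite -relation_yz -relation_xy; apply: tree_refines_Node.
- exists A1, (Node YCaret A2 A3 B), C => u.
  by rewrite relation_xy; apply: tree_refines_Node.
- by exists A, B, C.
- exists A, (Node ZCaret B C1 C2), C3 => u.
  by rewrite -relation_yz; apply: tree_refines_Node.
- exists A1, (Node YCaret A2 A3 B4), (Node YCaret B5 B6 C) => u.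
  by rewrite relation_xy relation_yz; apply: tree_refines_Node.
- exists A, B4, (Node YCaret B5 B6 C) => u.
  by rewrite relation_yz; apply: tree_refines_Node.
- by exists A, B, C.
Qed.

Lemma common_refinement t t' : exists r, tree_refines t r /\ tree_refines t' r.
Proof.
elim: t t' => [|c A IHA B IHB C IHC] t'.
  by exists t'; split; [apply: tree_refines_Leaf | apply: tree_refines_refl].
have [A' [B' [C' ref_t']]] := reroot t' c.
have [WA [refA refA']] := IHA A'; have [WB [refB refB']] := IHB B'.
have [WC [refC refC']] := IHC C'; exists (Node c WA WB WC); split.
  exact: tree_refines_Node.
by apply: tree_refines_trans ref_t' _; apply: tree_refines_Node.
Qed.

End Intervals.


(** * Charts and their defects *)

Section Charts.
Variable R : realType.
Local Notation beta := (beta R).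
Local Notation interval := (R * R)%type.
Local Notation unit_ioc := (unit_ioc R).
Implicit Types (c : caret) (u v w : interval) (s : seq interval).
Implicit Types (k : interval -> interval -> bool).
Implicit Types (d : interval * interval) (D E : seq (interval * interval)).
Implicit Types (f g : bijection unit_ioc).

Definition affine_on f u v :=
  forall x : unit_ioc, val x \in `]u.1, u.1 + u.2] ->
    val (f x) = v.1 + v.2 / u.2 * (val x - u.1).

Definition chart f D :=
  [/\ subdivision (unzip1 D), subdivision (unzip2 D) &
      forall d, d \in D -> affine_on f d.1 d.2].

(** The first condition makes the defect of a chart independent of the order of
    its entries, the other two make it invariant when an entry is split. *)
Definition additive_weight k :=
  [/\ exists b, forall u v, standard u -> standard v -> apart u v ->
        k u v (+) k v u = b,
      forall c u w, standard u -> standard w -> apart u w ->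
        \big[addb/false]_(v <- children c u) k v w = k u w &
      forall c u v, standard u -> standard v ->
        pair_parity k (children c u) = pair_parity k (children c v)].

Definition defect k D := pair_parity k (unzip1 D) (+) pair_parity k (unzip2 D).

(** The weight of the sources and the weight of the targets change by the same
    bit when two entries are exchanged, so their sum is symmetric. *)
Lemma defect_perm k D E : additive_weight k ->
  subdivision (unzip1 D) -> subdivision (unzip2 D) -> perm_eq D E ->
  defect k D = defect k E.
Proof.
case=> [[b k_sym] _ _] sub1 sub2 eqDE.
rewrite /defect /unzip1 /unzip2 !pair_parity_map -!pair_parity_addb.
apply: pair_parity_perm eqDE.
have std1 d : d \in D -> standard d.1.
  by move=> dD; apply: (subdivision_standard sub1); apply: map_f.
have std2 d : d \in D -> standard d.2.
  by move=> dD; apply: (subdivision_standard sub2); apply: map_f.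
have := subdivision_apart sub1; rewrite pairwise_map => ap1.
have := subdivision_apart sub2; rewrite pairwise_map => ap2.
have : pairwise (fun d e => apart d.1 e.1 && apart d.2 e.2) D.
  by rewrite (pairwise_relI (fun d e => apart d.1 e.1)) ap1.
apply: (@sub_in_pairwise _ [in D]); last exact/allP.
move=> d e dD eD /= /andP[ap_d ap_e].
have := k_sym _ _ (std1 d dD) (std1 e eD) ap_d.
have <- := k_sym _ _ (std2 d dD) (std2 e eD) ap_e.
by do 4![case: (k _ _)].
Qed.

Lemma chart_perm f D E : chart f D -> perm_eq D E -> chart f E.
Proof.
case=> [[S eqS] [T eqT] aff] eqDE; split.
- by exists S; apply: perm_trans eqS; rewrite perm_sym perm_map.
- by exists T; apply: perm_trans eqT; rewrite perm_sym perm_map.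
- by move=> d; rewrite -(perm_mem eqDE); apply: aff.
Qed.

(** * Splitting an entry of a chart *)

Definition child_pairs c d := [seq (cell d.1 o, cell d.2 o) | o <- cells R c].

Lemma unzip1_child_pairs c d D :
  unzip1 (child_pairs c d ++ D) = children c d.1 ++ unzip1 D.
Proof. by rewrite /unzip1 map_cat -map_comp. Qed.

Lemma unzip2_child_pairs c d D :
  unzip2 (child_pairs c d ++ D) = children c d.2 ++ unzip2 D.
Proof. by rewrite /unzip2 map_cat -map_comp. Qed.

Lemma pair_parity_children k c u s : additive_weight k -> subdivision (u :: s) ->
  pair_parity k (children c u ++ s)
    = pair_parity k (u :: s) (+) pair_parity k (children c u).
Proof.
case=> _ k_split _ sub_us; rewrite pair_parity_cat exchange_big.
have std v : v \in u :: s -> standard v by apply: subdivision_standard.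
have /= /andP[/allP ap _] := subdivision_apart sub_us.
have -> : \big[addb/false]_(w <- s) \big[addb/false]_(v <- children c u) k v w
        = \big[addb/false]_(w <- s) k u w.
  apply: eq_big_seq => w ws; apply: k_split; last exact: ap.
    exact/std/mem_head.
  by apply: std; rewrite inE ws orbT.
by rewrite /= addbC addbA addbAC.
Qed.

(** An affine map commutes with the rescaling that defines cells. *)
Lemma affine_on_cell f c u v o : standard u -> standard v -> o \in cells R c ->
  affine_on f u v -> affine_on f (cell u o) (cell v o).
Proof.
move=> /standard_gt0 u0 /standard_gt0 v0 /cells_cases[o1 o12 oE] aff x.
have o0 : 0 < o.2 by case: oE => ->; [exact: beta_gt0 | exact: beta_sqr_gt0].
rewrite !in_itv /= => /andP[x1 x2]; rewrite aff; last first.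
  by rewrite in_itv /=; apply/andP; split; nra.
rewrite /cell /=; by field; rewrite !gt_eqF.
Qed.

Lemma chart_step f c d D : chart f (d :: D) -> chart f (child_pairs c d ++ D).
Proof.
case=> sub1 sub2 aff; split.
- by rewrite unzip1_child_pairs; apply: subdivision_step.
- by rewrite unzip2_child_pairs; apply: subdivision_step.
- move=> e; rewrite mem_cat => /orP[/mapP[o o_c ->]|eD]; last first.
    by apply: aff; rewrite inE eD orbT.
  apply: (affine_on_cell _ _ o_c); last exact/aff/mem_head.
    exact: subdivision_standard sub1 (mem_head _ _).
  exact: subdivision_standard sub2 (mem_head _ _).
Qed.

(** The weights among the children of the source and among the children of the
    target are equal, because both come from the caret c. *)
Lemma defect_step k f c d D : additive_weight k -> chart f (d :: D) ->
  defect k (child_pairs c d ++ D) = defect k (d :: D).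
Proof.
move=> k_add [sub1 sub2 _].
rewrite /defect unzip1_child_pairs unzip2_child_pairs !pair_parity_children //.
have [_ _ /(_ c d.1 d.2) ->] := k_add.
- set a := pair_parity k (_ :: _); set b := pair_parity k (_ :: _).
  by case: a; case: b; case: (pair_parity k (children _ _)).
- exact: subdivision_standard sub1 (mem_head _ _).
- exact: subdivision_standard sub2 (mem_head _ _).
Qed.

(** Splitting the sources as prescribed splits the targets by the same carets,
    so the targets remain the leaves of some tree. *)
Lemma chart_refine f D s s' : refines s s' -> chart f D -> perm_eq (unzip1 D) s ->
  exists E, [/\ chart f E, perm_eq (unzip1 E) s' &
    forall k, additive_weight k -> defect k E = defect k D].
Proof.
move=> ref; elim: ref D => {s s'} [s|s1 c u s2 s' _ IH] D fD eqD; first by exists D.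
have /mapP[d dD du] : u \in unzip1 D by rewrite (perm_mem eqD) mem_cat mem_head orbT.
have eqDd := perm_to_rem dD; set D' := rem d D in eqDd.
have fD' := chart_perm fD eqDd.
have eqD' : perm_eq (unzip1 D') (s1 ++ s2).
  have eq_us : perm_eq (s1 ++ u :: s2) (u :: s1 ++ s2).
    by rewrite (perm_catCA s1 [:: u] s2).
  rewrite -(perm_cons u); apply: perm_trans eq_us; apply: perm_trans eqD.
  by rewrite du perm_sym; apply: (perm_map fst eqDd).
have [] := IH (child_pairs c d ++ D').
- exact: chart_step.
- rewrite unzip1_child_pairs -du.
  by rewrite perm_sym perm_catCA perm_cat2l perm_sym.
- move=> E [fE eqE defE]; exists E; split=> // k k_add.
  rewrite defE // (defect_step _ k_add fD').
  by case: fD => sub1 sub2 _; rewrite (defect_perm k_add sub1 sub2 eqDd).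
Qed.

(** * Inverses and products of charts *)

Lemma affine_on_inv f u v : standard u -> standard v ->
  affine_on f u v -> affine_on f^-1%g v u.
Proof.
move=> std_u std_v aff y; rewrite in_itv /= => /andP[y1 y2].
have u0 := standard_gt0 std_u; have v0 := standard_gt0 std_v.
case: std_u => _ u_ge0 u_le1.
pose x := u.1 + u.2 / v.2 * (val y - v.1).
have r0 : 0 < u.2 / v.2 by rewrite divr_gt0.
have x_gt : u.1 < x by rewrite ltrDl mulr_gt0 // subr_gt0.
have x_le : x <= u.1 + u.2.
  by rewrite lerD2l mulrAC ler_pdivrMr // ler_pM2l // lerBlDl.
have x_unit : x \in `]0, 1].
  by rewrite in_itv /=; apply/andP; split; lra.
suff fx : f (exist _ x x_unit) = y by rewrite -{1}fx bij_funK.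
apply/val_inj; rewrite aff /=; last by rewrite in_itv /= x_gt.
by rewrite /x /=; field; rewrite !gt_eqF.
Qed.

Definition swap_pairs D := [seq (d.2, d.1) | d <- D].

Lemma unzip1_swap D : unzip1 (swap_pairs D) = unzip2 D.
Proof. by rewrite /unzip1 -map_comp. Qed.

Lemma unzip2_swap D : unzip2 (swap_pairs D) = unzip1 D.
Proof. by rewrite /unzip2 -map_comp. Qed.

Lemma defect_swap k D : defect k (swap_pairs D) = defect k D.
Proof. by rewrite /defect unzip1_swap unzip2_swap addbC. Qed.

Lemma chart_inv f D : chart f D -> chart f^-1%g (swap_pairs D).
Proof.
case=> sub1 sub2 aff; split; rewrite ?unzip1_swap ?unzip2_swap //.
move=> _ /mapP[d dD ->]; apply: affine_on_inv; last exact: aff.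
  by apply: (subdivision_standard sub1); apply: map_f.
by apply: (subdivision_standard sub2); apply: map_f.
Qed.

Lemma chart_refine_target f D s s' : refines s s' -> chart f D ->
  perm_eq (unzip2 D) s ->
  exists E, [/\ chart f E, perm_eq (unzip2 E) s' &
    forall k, additive_weight k -> defect k E = defect k D].
Proof.
move=> ref /chart_inv fD; rewrite -unzip1_swap => eqD.
have [E [fE eqE defE]] := chart_refine ref fD eqD; exists (swap_pairs E); split.
- by have := chart_inv fE; rewrite invgK.
- by rewrite unzip2_swap.
- by move=> k k_add; rewrite defect_swap defE // defect_swap.
Qed.

Lemma affine_on_mul f g u v w : standard u -> standard v ->
  affine_on g u v -> affine_on f v w -> affine_on (f * g)%g u w.
Proof.
move=> /standard_gt0 u0 /standard_gt0 v0 aff_g aff_f x x_u.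
have gx := aff_g x x_u; move: x_u; rewrite in_itv /= => /andP[x1 x2].
rewrite /= in gx *; rewrite aff_f /= gx.
  by field; rewrite !gt_eqF.
have r0 : 0 < v.2 / u.2 by rewrite divr_gt0.
rewrite in_itv /= ltrDl mulr_gt0 ?subr_gt0 //=.
by rewrite lerD2l mulrAC ler_pdivrMr // ler_pM2l // lerBlDl.
Qed.

(** Refine the sources of f and the targets of g to the leaves of a common tree
    and match them; the middle weights then occur twice and cancel. *)
Lemma chart_mul f g D E : chart f D -> chart g E ->
  exists F, chart (f * g)%g F /\
    forall k, additive_weight k -> defect k F = defect k D (+) defect k E.
Proof.
move=> fD gE; case: (fD) (gE) => [[S eqS] _ _] [_ [T eqT] _].
have [r [refS refT]] := common_refinement R S T.
have [D1 [fD1 eqD1 defD1]] := chart_refine (refS (0, 1)) fD eqS.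
have [E2 [gE1 eqE2 defE2]] := chart_refine_target (refT (0, 1)) gE eqT.
have /perm_map_lift[D2 eqD12 D2E] : perm_eq (unzip1 D1) (unzip2 E2).
  by apply: perm_trans eqD1 _; rewrite perm_sym.
have fD2 : chart f D2 by apply: chart_perm fD1 _; rewrite perm_sym.
have eq_size : size D2 = size E2.
  by have /(congr1 size) := D2E; rewrite !size_map.
have eq_unzip : size (unzip1 E2) = size (unzip2 D2).
  by rewrite size_map [RHS]size_map eq_size.
exists (zip (unzip1 E2) (unzip2 D2)).
have F1 : unzip1 (zip (unzip1 E2) (unzip2 D2)) = unzip1 E2.
  by rewrite unzip1_zip // eq_unzip.
have F2 : unzip2 (zip (unzip1 E2) (unzip2 D2)) = unzip2 D2.
  by rewrite unzip2_zip // eq_unzip.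
split; last first.
  move=> k k_add; rewrite {1}/defect F1 F2.
  have -> : defect k E = defect k E2 by rewrite defE2.
  have -> : defect k D = defect k D2.
    by rewrite -defD1 //; case: fD2 => ? ? _; rewrite (defect_perm k_add _ _ eqD12).
  rewrite /defect (_ : unzip1 D2 = unzip2 E2) //.
  by case: (pair_parity k (unzip1 E2)); case: (pair_parity k (unzip2 E2));
    case: (pair_parity k (unzip2 D2)).
case: fD2 gE1 => subD1 subD2 affD [subE1 subE2 affE].
split; rewrite ?F1 ?F2 // => e /(nthP (0, 0, (0, 0)))[i].
rewrite size_zip eq_unzip minnn size_map eq_size => lt_i <-.
rewrite nth_zip //=.
rewrite (nth_map (0, 0, (0, 0))) // (nth_map (0, 0, (0, 0))) ?eq_size //.
set e1 := nth _ E2 i; set d1 := nth _ D2 i.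
have e1E : e1 \in E2 by apply: mem_nth.
have d1D : d1 \in D2 by apply: mem_nth; rewrite eq_size.
have e1d1 : e1.2 = d1.1.
  rewrite -(nth_map _ (0, 0) snd) // -(nth_map _ (0, 0) fst) ?eq_size //.
  by rewrite -[map snd E2]D2E.
apply: (@affine_on_mul _ _ _ e1.2); [| | exact: affE | rewrite e1d1; exact: affD].
  by apply: (subdivision_standard subE1); apply: map_f.
by apply: (subdivision_standard subE2); apply: map_f.
Qed.

Lemma chart_one : chart 1%g [:: ((0, 1), (0, 1))].
Proof.
split; try by exists Leaf.
move=> d; rewrite inE => /eqP-> x _ /=.
by rewrite divr1 mul1r add0r subr0.
Qed.

(** A pair of intervals on which the identity is the affine map consists of two
    equal intervals, so that sources and targets are the same list. *)
Lemma defect_one k D : chart 1%g D -> defect k D = false.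
Proof.
case=> sub1 sub2 aff; rewrite /defect.
suff -> : unzip1 D = unzip2 D by rewrite addbb.
apply/eq_in_map => d dD.
have std1 : standard d.1 by apply: (subdivision_standard sub1); apply: map_f.
have std2 : standard d.2 by apply: (subdivision_standard sub2); apply: map_f.
have {aff} := aff _ dD; have u0 := standard_gt0 std1.
case: std1 => _ ge0 le1; case: d {dD std2} u0 ge0 le1 => [[a L] [b M]] /= L0 a0 aL1.
move=> aff; have at_point x : a < x -> x <= a + L -> x = b + M / L * (x - a).
  move=> ax xaL; have x_unit : x \in `]0, 1].
    by rewrite in_itv /=; apply/andP; split; lra.
  by have := aff (exist _ x x_unit); rewrite in_itv /= ax xaL => /(_ isT) <-.
(* Two points of the interval determine the affine map. *)
have end_point : a + L = b + M.
  rewrite {1}(at_point (a + L)) ?lexx ?ltrDl //; field; exact: lt0r_neq0.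
have mid_point : a + L / 2 = b + M / 2.
  rewrite {1}(at_point (a + L / 2)); [field; exact: lt0r_neq0|lra|lra].
by congr pair; lra.
Qed.

(** Compose one chart with the inverse of the other to get a chart of 1. *)
Lemma defect_unique k f D E : additive_weight k ->
  chart f D -> chart f E -> defect k D = defect k E.
Proof.
move=> k_add fD /chart_inv fE; have [F [FP /(_ k k_add)]] := chart_mul fD fE.
rewrite mulgV in FP; rewrite (defect_one _ FP) defect_swap.
by case: (defect k D); case: (defect k E).
Qed.

(** From a triple (T, p, S), pair leaf i of S with leaf p(i) of T; conversely
    order the entries by their sources and read off p from the targets. *)
Lemma Vbeta_chart f : Vbeta R f <-> exists D, chart f D.
Proof.
split=> [[k [T [S [p [szT szS fTS]]]]]|[D fD]].
  pose d i := (nth (0, 0) (leaves R S) (val i), nth (0, 0) (leaves R T) (p i)).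
  have enum_leaves t : size (leaves R t) = k ->
      leaves R t = [seq nth (0, 0) (leaves R t) (val i) | i <- enum 'I_k].
    by move=> <-; rewrite (map_comp (nth (0, 0) _)) val_enum_ord [RHS]mkseq_nth.
  exists (map d (enum 'I_k)); split.
  - by exists S; rewrite /unzip1 -map_comp -enum_leaves.
  - exists T; rewrite [X in perm_eq _ X](enum_leaves T) // /unzip2 -map_comp.
    rewrite (map_comp (fun i : 'I_k => nth (0, 0) (leaves R T) i) p); apply: perm_map.
    apply: uniq_perm; rewrite ?enum_uniq ?(map_inj_uniq (@perm_inj _ p)) ?enum_uniq //.
    move=> i; rewrite mem_enum; apply/mapP; exists (p^-1 i)%g; rewrite ?mem_enum //.
    by rewrite permKV.
  - move=> _ /mapP[i _ ->] x /=; move: (fTS i x).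
    by case: (nth _ _ (val i)) => a L; case: nth => b M /=; apply.
case: (fD) => [[S /perm_map_lift[D' eqD D'S]] _ _].
have {D fD eqD} [_ [T eqT] aff] : chart f D'.
  by apply: chart_perm fD _; rewrite perm_sym.
have /tuple_permP[p D'T] : perm_eq (unzip2 D') (in_tuple (leaves R T)) by [].
exists (size (leaves R T)), T, S, p.
have szT : size (leaves R T) = size D' by rewrite -(perm_size eqT) size_map.
have szS : size (leaves R S) = size D' by rewrite -D'S size_map.
split; rewrite ?szS ?szT // => i x.
have lt_i : (i < size D')%N by rewrite -szT.
have := aff _ (mem_nth (0, 0, (0, 0)) lt_i) x.
have -> : nth (0, 0) (leaves R S) i = (nth (0, 0, (0, 0)) D' i).1.
  by rewrite -D'S (nth_map (0, 0, (0, 0))).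
have -> : nth (0, 0) (leaves R T) (p i) = (nth (0, 0, (0, 0)) D' i).2.
  rewrite -(nth_map _ (0, 0) snd) // [map snd D']D'T.
  by rewrite -tnth_nth tnth_mktuple (tnth_nth (0, 0)).
by case: nth => [[a L] [b M]].
Qed.

End Charts.


(** * Two additive weights *)

Section Weights.
Variable R : realType.
Local Notation beta := (beta R).
Local Notation interval := (R * R)%type.
Implicit Types (c : caret) (u v w o : interval).

Definition order_weight u v := u.1 < v.1.

(** The parity of the exponent n when L is beta^n; the exponent is unique since
    0 < beta < 1. *)
Definition odd_level (L : R) : bool := `[< exists n, L = beta ^+ n.*2.+1 >].

(** Symmetric in u and v as soon as they start at different points: the levels
    have different parities and the leftmost one is odd. *)
Definition level_weight u v :=
  (odd_level u.2 (+) odd_level v.2) &&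
  (if u.1 < v.1 then odd_level u.2 else odd_level v.2).

Lemma odd_level_expn n : odd_level (beta ^+ n) = odd n.
Proof.
apply/asboolP/idP => [[m /beta_expn_inj->]|odd_n]; first by rewrite /= odd_double.
by exists n./2; rewrite -[in LHS](odd_double_half n) odd_n.
Qed.

Lemma odd_level_lengths : odd_level beta /\ odd_level (beta ^+ 2) = false.
Proof. by rewrite -{1}[beta]expr1 !odd_level_expn. Qed.

Lemma odd_level_beta u : standard u -> odd_level (beta * u.2) = ~~ odd_level u.2.
Proof. by case=> [[n ->] _ _]; rewrite -exprS !odd_level_expn. Qed.

Lemma odd_level_beta2 u : standard u -> odd_level (beta ^+ 2 * u.2) = odd_level u.2.
Proof. by case=> [[n ->] _ _]; rewrite -exprD !odd_level_expn /= negbK. Qed.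

Lemma apart_lt u v : standard u -> standard v -> apart u v ->
  (v.1 < u.1) = ~~ (u.1 < v.1).
Proof.
move=> /standard_gt0 u0 /standard_gt0 v0 /orP[] le.
  by rewrite -leNgt; apply/idP/idP; lra.
by rewrite -leNgt; apply/idP/idP; lra.
Qed.

Lemma child_lt c u v w : standard u -> standard w -> apart u w ->
  v \in children c u -> (v.1 < w.1) = (u.1 < w.1).
Proof.
move=> std_u std_w ap /(child_standard std_u)[/standard_gt0 v0 /andP[uv vu]].
have u0 := standard_gt0 std_u; have w0 := standard_gt0 std_w.
case/orP: ap => le; first by apply/idP/idP => _; lra.
by apply/idP/idP => lt; lra.
Qed.

Lemma children_lt c u : standard u ->
  [/\ (cell u (cells R c)`_0).1 < (cell u (cells R c)`_1).1,
      (cell u (cells R c)`_0).1 < (cell u (cells R c)`_2).1 &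
      (cell u (cells R c)`_1).1 < (cell u (cells R c)`_2).1].
Proof.
move=> /standard_gt0; case: u => a L /= L0.
have bL := mulr_gt0 (beta_gt0 R) L0; have b2L := mulr_gt0 (beta_sqr_gt0 R) L0.
by case: c => /=; split; lra.
Qed.

Lemma pair_parity_children3 k c u :
  pair_parity k (children c u) =
    k (cell u (cells R c)`_0) (cell u (cells R c)`_1) (+)
    k (cell u (cells R c)`_0) (cell u (cells R c)`_2) (+)
    k (cell u (cells R c)`_1) (cell u (cells R c)`_2).
Proof.
by rewrite /children; case: c; rewrite /= !big_cons !big_nil !addbF.
Qed.

(** Three children weigh as much as one parent because 3 is odd. *)
Lemma order_weight_additive : additive_weight order_weight.
Proof.
split.
- exists true => u v std_u std_v ap.
  by rewrite /order_weight (apart_lt std_u std_v ap) addbN addbb.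
- move=> c u w std_u std_w ap.
  rewrite (eq_big_seq (fun=> u.1 < w.1)) => [|v vc]; last exact: child_lt vc.
  rewrite big_map /order_weight; case: c; rewrite !big_cons big_nil; by case: (_ < _).
- move=> c u v std_u std_v; rewrite !pair_parity_children3 /order_weight.
  by have [-> -> ->] := children_lt c std_u; have [-> -> ->] := children_lt c std_v.
Qed.

Lemma odd_level_cell u o : standard u -> o.2 = beta \/ o.2 = beta ^+ 2 ->
  odd_level (cell u o).2 = odd_level u.2 (+) odd_level o.2.
Proof.
move: odd_level_lengths => [odd1 odd2] std_u [] /= ->.
  by rewrite odd_level_beta // odd1; case: odd_level.
by rewrite odd_level_beta2 // odd2; case: odd_level.
Qed.

Lemma odd_level_cells c :
  [seq odd_level o.2 | o <- cells R c] =
  match c with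
  | XCaret => [:: false; true; true]
  | YCaret => [:: true; false; true]
  | ZCaret => [:: true; true; false]
  end.
Proof.
by have [odd1 odd2] := odd_level_lengths; case: c; rewrite /= odd1 odd2.
Qed.

Lemma odd_level_children c u : standard u ->
  [seq odd_level v.2 | v <- children c u] =
  [seq odd_level u.2 (+) b | b <- [seq odd_level o.2 | o <- cells R c]].
Proof.
move=> std_u; rewrite -!map_comp; apply/eq_in_map => o oc.
by apply: odd_level_cell => //; case: (cells_cases oc).
Qed.

(** With levels of parity p for the child of length beta^2 L and p+1 for the
    two others, the pairs of equal parity weigh 0.  When the special child
    stands at an end, its two pairs weigh the same; when it stands in the
    middle, exactly one of its pairs weighs 1. *)
Lemma pair_parity_level_children c u : standard u ->
  pair_parity level_weight (children c u) = if c is YCaret then true else false.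
Proof.
move=> std_u; rewrite pair_parity_children3 /level_weight.
have [-> -> ->] := children_lt c std_u.
have := odd_level_children c std_u; rewrite odd_level_cells /children.
by case: c => /= -[e0 e1 e2]; rewrite !(e0, e1, e2); case: (odd_level u.2).
Qed.

(** The two children of length beta L have the same level and lie on the same
    side of any other interval, so their contributions cancel; the child of
    length beta^2 L has the parity of its parent. *)
Lemma level_weight_additive : additive_weight level_weight.
Proof.
split.
- exists false => u v std_u std_v ap.
  rewrite /level_weight (apart_lt std_u std_v ap).
  by case: (_ < _); case: (odd_level u.2); case: (odd_level v.2).
- move=> c u w std_u std_w ap.
  pose h b := (b (+) odd_level w.2) && (if u.1 < w.1 then b else odd_level w.2).
  rewrite (eq_big_seq (fun v => h (odd_level v.2))) => [|v vc]; last first.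
    by rewrite /level_weight (child_lt std_u std_w ap vc).
  rewrite -(big_map (fun v => odd_level v.2) predT h) odd_level_children //.
  rewrite odd_level_cells /level_weight /h.
  case: c; rewrite !big_cons big_nil;
    by case: (_ < _); case: (odd_level u.2); case: (odd_level w.2).
- by move=> c u v std_u std_v; rewrite !pair_parity_level_children.
Qed.

End Weights.

(** * Exchanging two intervals *)

Section Exchange.
Variable R : realType.
Local Notation beta := (beta R).

(** On (0, p + q], the exchange of the intervals (0, p] and (p, p + q]. *)
Definition exchange_fun (p q x : R) : R :=
  if x <= p then x + q else if x <= p + q then x - p else x.

Lemma exchange_fun_unit p q x : 0 < p -> 0 < q -> p + q <= 1 ->
  x \in `]0, 1] -> exchange_fun p q x \in `]0, 1].
Proof.
move=> p0 q0 pq1; rewrite !in_itv /exchange_fun /= => /andP[x0 x1].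
by case: (leP x p) => xp; [|case: (leP x (p + q)) => xpq]; apply/andP; split; lra.
Qed.

Lemma exchange_funK p q x : 0 < p -> 0 < q -> 0 < x ->
  exchange_fun q p (exchange_fun p q x) = x.
Proof.
move=> p0 q0 x0; rewrite /exchange_fun.
case: (leP x p) => xp.
  have -> : (x + q <= q) = false by apply/negbTE; rewrite -ltNge; lra.
  have -> : x + q <= q + p by lra.
  by rewrite addrK.
case: (leP x (p + q)) => xpq.
  have -> : x - p <= q by lra.
  by rewrite subrK.
have -> : (x <= q) = false by apply/negbTE; rewrite -ltNge; lra.
by have -> : (x <= q + p) = false by apply/negbTE; rewrite -ltNge; lra.
Qed.

Section Bijection.
Variables p q : R.
Hypotheses (p0 : 0 < p) (q0 : 0 < q) (pq1 : p + q <= 1).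

Definition exchange_unit (x : unit_ioc R) : unit_ioc R :=
  exist _ (exchange_fun p q (val x)) (exchange_fun_unit p0 q0 pq1 (valP x)).

Lemma exchange_subproof : q + p <= 1. Proof. by rewrite addrC. Qed.

Definition exchange_unitV (x : unit_ioc R) : unit_ioc R :=
  exist _ (exchange_fun q p (val x)) (exchange_fun_unit q0 p0 exchange_subproof (valP x)).

Lemma exchange_unitK : cancel exchange_unit exchange_unitV.
Proof.
move=> x; apply/val_inj => /=; apply: exchange_funK => //.
by have := valP x; rewrite in_itv /= => /andP[].
Qed.

Lemma exchange_unitVK : cancel exchange_unitV exchange_unit.
Proof.
move=> x; apply/val_inj => /=; apply: exchange_funK => //.
by have := valP x; rewrite in_itv /= => /andP[].
Qed.

Definition exchange : bijection (unit_ioc R) :=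
  Bijection exchange_unitK exchange_unitVK.

Definition exchange_pairs (r : R) : seq ((R * R) * (R * R)) :=
  [:: ((0, p), (q, p)); ((p, q), (0, q)); ((p + q, r), (q + p, r))].

Lemma exchange_chart (r : R) : 0 < r -> subdivision [:: (0, p); (p, q); (p + q, r)] ->
  subdivision [:: (0, q); (q, p); (q + p, r)] -> chart exchange (exchange_pairs r).
Proof.
move=> r0 sub1 [T eqT]; split=> //.
  by exists T; apply: perm_trans eqT; apply/seq.permP => a /=; lia.
move=> d; rewrite !inE => /or3P[] /eqP-> [x x_unit];
  rewrite in_itv /= => /andP[x1 x2]; rewrite /exchange_fun.
- rewrite add0r in x2; rewrite x2; field; exact: lt0r_neq0.
- rewrite x2 leNgt x1 /=; field; exact: lt0r_neq0.
- have -> : (x <= p) = false by apply/negbTE; rewrite -ltNge (lt_trans _ x1) ?ltrDl.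
  rewrite leNgt x1 /=; field; exact: lt0r_neq0.
Qed.

Lemma exchange_level (r : R) :
  defect (@level_weight R) (exchange_pairs r) =
    pair_parity (@level_weight R) [:: (0, p); (p, q); (p + q, r)] (+)
    pair_parity (@level_weight R) [:: (0, q); (q, p); (q + p, r)].
Proof.
rewrite /defect; congr addb; rewrite /= !big_cons !big_nil !addbF.
have -> : level_weight (q, p) (0, q) = level_weight (0, q) (q, p).
  by rewrite /level_weight /= q0 [q < 0]ltNge (ltW q0) addbC.
by rewrite -!addbA; congr addb; rewrite addbC.
Qed.

Lemma exchange_order (r : R) : defect (@order_weight R) (exchange_pairs r).
Proof.
rewrite /defect /= !big_cons !big_nil /order_weight /=.
have -> : (q < 0) = false by apply/negbTE; rewrite -leNgt ltW.
by rewrite !ltrDl p0 q0 !addr_gt0.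
Qed.

End Bijection.

End Exchange.

(** * The homomorphism onto (Z/2)^2 *)

Section Index.
Variable R : realType.
Local Notation beta := (beta R).
Implicit Types (f g : bijection (unit_ioc R)).

Lemma cells_children c : cells R c = children c (0, 1).
Proof.
rewrite /children -[LHS]map_id; apply: eq_map => -[a L].
by rewrite /cell /= !mulr1 add0r.
Qed.

Lemma cells_subdivision c : subdivision (cells R c).
Proof.
exists (Node c Leaf Leaf Leaf).
rewrite leavesE intervals_in_Node !intervals_in_Leaf {1}cells_children.
by case: c; apply: perm_refl.
Qed.

Lemma pair_parity_level_cells c :
  pair_parity (@level_weight R) (cells R c) = if c is YCaret then true else false.
Proof. by rewrite cells_children pair_parity_level_children //; apply: unit_standard. Qed.

(** The bit is read off from any chart of f, by defect_unique. *)
Definition parity k f := `[< exists2 D, chart f D & defect k D >].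

Lemma parityE k f D : additive_weight k -> chart f D -> parity k f = defect k D.
Proof.
move=> k_add fD; apply/asboolP/idP => [[E fE]|]; last by exists D.
by rewrite (defect_unique k_add fD fE).
Qed.

Lemma parityM k f g : additive_weight k -> Vbeta R f -> Vbeta R g ->
  parity k (f * g)%g = parity k f (+) parity k g.
Proof.
move=> k_add /Vbeta_chart[D fD] /Vbeta_chart[E gE].
have [F [fgF /(_ k k_add) defF]] := chart_mul fD gE.
by rewrite (parityE k_add fD) (parityE k_add gE) (parityE k_add fgF).
Qed.

Lemma Vbeta_subgroup : subgroup (Vbeta R).
Proof.
split; first by apply/mem_set/Vbeta_chart; exists [:: ((0, 1), (0, 1))]; apply: chart_one.
move=> f g /set_mem/Vbeta_chart[D fD] /set_mem/Vbeta_chart[E gE].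
have [F [fgF _]] := chart_mul fD (chart_inv gE).
by apply/mem_set/Vbeta_chart; exists F.
Qed.

(** Witness: exchange the first two leaves of a z-caret, which have the same
    length, so that both trees are the same caret. *)
Lemma exists_swap : exists2 f, Vbeta R f &
  parity (@order_weight R) f /\ parity (@level_weight R) f = false.
Proof.
have b0 := beta_gt0 R; have b20 := beta_sqr_gt0 R; have b2 := beta_sqr R.
have le1 : beta + beta <= 1 by lra.
have sub := cells_subdivision ZCaret.
have fD := exchange_chart b0 b0 le1 b20 sub sub.
exists (exchange b0 b0 le1); first by apply/Vbeta_chart; eexists; apply: fD.
rewrite (parityE (order_weight_additive R) fD) exchange_order //.
by rewrite (parityE (level_weight_additive R) fD) exchange_level // addbb.
Qed.

(** Witness: exchange the first two leaves of an x-caret, of lengths beta^2 and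
    beta; the result is subdivided as by a y-caret. *)
Lemma exists_recaret : exists2 f, Vbeta R f &
  parity (@order_weight R) f /\ parity (@level_weight R) f.
Proof.
have b0 := beta_gt0 R; have b20 := beta_sqr_gt0 R; have b2 := beta_sqr R.
have le1 : beta ^+ 2 + beta <= 1 by lra.
have fD := exchange_chart b20 b0 le1 b0 (cells_subdivision XCaret)
  (cells_subdivision YCaret).
exists (exchange b20 b0 le1); first by apply/Vbeta_chart; eexists; apply: fD.
rewrite (parityE (order_weight_additive R) fD) exchange_order //.
rewrite (parityE (level_weight_additive R) fD) exchange_level //.
by rewrite (pair_parity_level_cells XCaret) (pair_parity_level_cells YCaret).
Qed.

End Index.

Lemma card_bool2 : ([set: bool * bool]%classic #= `I_4)%card.
Proof.
pose h (i : nat) := (odd i, (2 <= i)%N).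
rewrite (_ : [set: _]%classic = [set h i | i in `I_4]%classic).
  apply: inj_card_eq => i j; rewrite !inE /=.
  by case: i => [|[|[|[|]]]] //; case: j => [|[|[|[|]]]].
apply/seteqP; split=> // -[[] []] _.
- by exists 3%N.
- by exists 1%N.
- by exists 2%N.
- by exists 0%N.
Qed.

Theorem theorem6p5 (R : realType) :
  exists N : set (bijection (unit_ioc R)),
    normal_subgroup N (Vbeta R) /\ has_index N (Vbeta R) 4.
Proof.
pose phi f := (parity (@order_weight R) f, parity (@level_weight R) f).
have phiM f g : Vbeta R f -> Vbeta R g -> phi (f * g)%g = phi f + phi g.
  move=> Vf Vg; rewrite /phi (parityM (order_weight_additive R)) //.
  by rewrite (parityM (level_weight_additive R)).
exists [set f | Vbeta R f /\ phi f = 0]%classic; split.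
  exact: kernel_normal (Vbeta_subgroup R) phiM.
apply: (kernel_index (Vbeta_subgroup R) phiM) card_bool2.
have V1 := set_mem (proj1 (Vbeta_subgroup R)).
have [f Vf [f1 f2]] := exists_swap R; have [g Vg [g1 g2]] := exists_recaret R.
have Vfg : Vbeta R (f * g)%g.
  by apply/set_mem/(group_closedM (Vbeta_subgroup R)); apply/mem_set.
have phi_f : phi f = (true, false) by rewrite /phi f1 f2.
have phi_g : phi g = (true, true) by rewrite /phi g1 g2.
move=> [[] []].
- by exists g.
- by exists f.
- by exists (f * g)%g; rewrite // phiM // phi_f phi_g.
- exists 1%g => //; apply: (addrI (phi 1%g)).
  by rewrite -phiM // mulg1 addr0.
Qed.
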